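(* Let $K$ be a field of characteristic zero (not necessarily algebraically closed) with algebraic closure $\overline K$, and let a $K$-algebra $A$ be a noncommutative domain of Gelfand-Kirillov dimension $<3$ such that the algebra $\overline A=\overline K\otimes_K A$ is a domain. Then the algebra $A$ admits the Dixmier partition.
   Context: Algebras are associative and unital. For a $K$-algebra $A$ with centre $Z(A)$, put $\overline A=\overline K\otimes_K A$ and identify $A$ with $1\otimes A$. For $a\in A$ let $\operatorname{ad} a: b\mapsto [a,b]=ab-ba$, and put $C(a)=\ker(\operatorname{ad} a)$; $N(a)=\bigcup_{i\ge0}\ker\big((\operatorname{ad} a)^{i+1}\big)\subseteq A$; $D(a)=A\cap\bigoplus_{\lambda\in\overline K}\{b\in\overline A:[a,b]=\lambda b\}$; $F(a)=\{b\in A:\dim_K K[\operatorname{ad} a]\,b<\infty\}$. Types of elements $a\in A\setminus Z(A)$: $a\in\Delta_1(A)$ (strongly nilpotent) if $N(a)=A$ and $D(a)=C(a)$; $a\in\Delta_2(A)$ (weakly nilpotent) if $C(a)\ne N(a)\ne A$ and $D(a)=C(a)$; $a\in\Delta_3(A)$ (strongly semi-simple) if $N(a)=C(a)$ and $D(a)=A$; $a\in\Delta_4(A)$ (weakly semi-simple) if $N(a)=C(a)$ and $C(a)\ne D(a)=F(a)\ne A$; $a\in\Delta_5(A)$ (generic) if $N(a)=D(a)=C(a)$. $A$ admits the Dixmier partition if $A\setminus Z(A)=\Delta_1(A)\cup\Delta_2(A)\cup\Delta_3(A)\cup\Delta_4(A)\cup\Delta_5(A)$; equivalently, for each $a\in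 A\setminus Z(A)$, either $F(a)=N(a)$ or $F(a)=D(a)$. *)

(* Defs.v *)
From HB Require Import structures.
From mathcomp Require Import all_boot all_order all_algebra.
From mathcomp Require Import all_classical all_reals all_analysis.

Set Implicit Arguments.
Unset Strict Implicit.
Unset Printing Implicit Defensive.

Import Order.TTheory GRing.Theory Num.Theory.
Local Open Scope classical_set_scope.
Local Open Scope quotient_scope.
Local Open Scope ring_scope.

(* The scalar extension E (x)_K A along iota : K -> E.  A finite formal sum    *)
(* of pairs (c, x) is a sequence; two formal sums are identified when every    *)
(* K-bilinear map on E * A takes the same value on them.  Here K acts on E     *)
(* through iota.                                                               *)
Section ScalarExtension.
Context {K E : fieldType} (iota : {rmorphism K -> E}) (A : algType K).

Definition bilinear_on (V : lmodType K) (f : E -> A -> V) : Prop :=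
  [/\ forall x c d, f (c + d) x = f c x + f d x,
      forall c x y, f c (x + y) = f c x + f c y,
      forall k c x, f (iota k * c) x = k *: f c x
    & forall k c x, f c (k *: x) = k *: f c x].

Definition formal_eval (V : lmodType K) (f : E -> A -> V)
  (s : seq (E * A)) : V :=
  \sum_(p <- s) f p.1 p.2.

Definition formal_eq (s t : seq (E * A)) : bool :=
  `[< forall (V : lmodType K) (f : E -> A -> V),
        bilinear_on f -> formal_eval f s = formal_eval f t >].

Fact formal_eq_equiv : equiv_class_of formal_eq.
Proof.
split=> [s|s t|t s u /asboolP st /asboolP tu]; first exact/asboolP.
  by apply/asboolP/asboolP => h V f /h.
by apply/asboolP => V f bf; rewrite st // tu.
Qed.

Canonical formal_equiv := EquivRelPack formal_eq_equiv.

Definition tensor : Type := {eq_quot formal_equiv}.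

HB.instance Definition _ : EqQuotient _ formal_equiv tensor :=
  EqQuotient.on tensor.
HB.instance Definition _ := Choice.on tensor.

Definition tensor_of (s : seq (E * A)) : tensor := \pi s.

Lemma tensor_ofP s t :
  (forall (V : lmodType K) (f : E -> A -> V),
     bilinear_on f -> formal_eval f s = formal_eval f t) <->
  tensor_of s = tensor_of t.
Proof.
by split=> [h|/eqmodP/asboolP //]; apply/eqmodP/asboolP.
Qed.

Lemma tensor_reprK (u : tensor) : tensor_of (repr u) = u.
Proof. exact: reprK. Qed.

Lemma tensor_ofW (P : tensor -> Prop) :
  (forall s, P (tensor_of s)) -> forall u, P u.
Proof. by move=> h u; rewrite -(tensor_reprK u). Qed.

Lemma repr_tensor_of s (V : lmodType K) (f : E -> A -> V) :
  bilinear_on f -> formal_eval f (repr (tensor_of s)) = formal_eval f s.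
Proof. by move: V f; apply/tensor_ofP; rewrite tensor_reprK. Qed.

Definition formal_opp (s : seq (E * A)) := [seq (- p.1, p.2) | p <- s].
Definition formal_scale (c : E) (s : seq (E * A)) :=
  [seq (c * p.1, p.2) | p <- s].
Definition formal_mul (s t : seq (E * A)) :=
  [seq (p.1 * q.1, p.2 * q.2) | p <- s, q <- t].

Lemma formal_eval_cat (V : lmodType K) (f : E -> A -> V) s t :
  formal_eval f (s ++ t) = formal_eval f s + formal_eval f t.
Proof. exact: big_cat. Qed.

Lemma formal_eval_scale (V : lmodType K) (f : E -> A -> V) c s :
  formal_eval f (formal_scale c s) = formal_eval (fun d => f (c * d)) s.
Proof. exact: big_map. Qed.

Lemma formal_eval_opp (V : lmodType K) (f : E -> A -> V) s :
  bilinear_on f -> formal_eval f (formal_opp s) = - formal_eval f s.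
Proof.
case=> fDl _ fZl _; rewrite /formal_eval big_map -sumrN.
apply: eq_bigr => p _ /=.
by rewrite -mulN1r -(rmorph1 iota) -rmorphN fZl scaleN1r.
Qed.

Lemma formal_eval_mul (V : lmodType K) (f : E -> A -> V) s t :
  formal_eval f (formal_mul s t) =
  formal_eval (fun c x => formal_eval (fun d y => f (c * d) (x * y)) t) s.
Proof. by rewrite /formal_eval /formal_mul big_allpairs_dep. Qed.

Lemma bilinear_scale (V : lmodType K) (f : E -> A -> V) c :
  bilinear_on f -> bilinear_on (fun d => f (c * d)).
Proof.
move=> [fDl fDr fZl fZr]; split=> *; rewrite ?mulrDr ?fDl ?fDr ?fZr //.
by rewrite mulrCA fZl.
Qed.

Lemma bilinear_mulr (V : lmodType K) (f : E -> A -> V) c x :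
  bilinear_on f -> bilinear_on (fun d y => f (c * d) (x * y)).
Proof.
move=> [fDl fDr fZl fZr]; split=> *; rewrite ?mulrDr ?fDl ?fDr //.
  by rewrite mulrCA fZl.
by rewrite -scalerAr fZr.
Qed.

Lemma bilinear_mull (V : lmodType K) (f : E -> A -> V) t :
  bilinear_on f ->
  bilinear_on (fun c x => formal_eval (fun d y => f (c * d) (x * y)) t).
Proof.
move=> [fDl fDr fZl fZr]; split=> *; rewrite /formal_eval.
- by rewrite -big_split; apply: eq_bigr => p _; rewrite mulrDl fDl.
- by rewrite -big_split; apply: eq_bigr => p _; rewrite mulrDl fDr.
- by rewrite scaler_sumr; apply: eq_bigr => p _; rewrite -mulrA fZl.
- by rewrite scaler_sumr; apply: eq_bigr => p _; rewrite -scalerAl fZr.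
Qed.

Definition tensor_add (u v : tensor) := tensor_of (repr u ++ repr v).
Definition tensor_opp (u : tensor) := tensor_of (formal_opp (repr u)).
Definition tensor_mul (u v : tensor) :=
  tensor_of (formal_mul (repr u) (repr v)).
Definition tensor_scale (c : E) (u : tensor) :=
  tensor_of (formal_scale c (repr u)).

Lemma tensor_addE s t :
  tensor_add (tensor_of s) (tensor_of t) = tensor_of (s ++ t).
Proof.
by apply/tensor_ofP => V f bf; rewrite !formal_eval_cat !repr_tensor_of.
Qed.

Lemma tensor_oppE s : tensor_opp (tensor_of s) = tensor_of (formal_opp s).
Proof.
by apply/tensor_ofP => V f bf; rewrite !formal_eval_opp // repr_tensor_of.
Qed.

Lemma tensor_scaleE c s :
  tensor_scale c (tensor_of s) = tensor_of (formal_scale c s).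
Proof.
apply/tensor_ofP => V f bf.
by rewrite !formal_eval_scale repr_tensor_of //; apply: bilinear_scale.
Qed.

Lemma tensor_mulE s t :
  tensor_mul (tensor_of s) (tensor_of t) = tensor_of (formal_mul s t).
Proof.
apply/tensor_ofP => V f bf; rewrite !formal_eval_mul repr_tensor_of.
  by apply: eq_bigr => p _; rewrite repr_tensor_of //; apply: bilinear_mulr.
exact: bilinear_mull.
Qed.

Fact tensor_addA : associative tensor_add.
Proof.
elim/tensor_ofW => s; elim/tensor_ofW => t; elim/tensor_ofW => u.
by rewrite !tensor_addE catA.
Qed.

Fact tensor_addC : commutative tensor_add.
Proof.
elim/tensor_ofW => s; elim/tensor_ofW => t; rewrite !tensor_addE.
by apply/tensor_ofP => V f _; rewrite !formal_eval_cat addrC.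
Qed.

Fact tensor_add0 : left_id (tensor_of [::]) tensor_add.
Proof. by elim/tensor_ofW => s; rewrite tensor_addE. Qed.

Fact tensor_addN : left_inverse (tensor_of [::]) tensor_opp tensor_add.
Proof.
elim/tensor_ofW => s; rewrite tensor_oppE tensor_addE.
apply/tensor_ofP => V f bf.
by rewrite formal_eval_cat formal_eval_opp // addNr /formal_eval big_nil.
Qed.

HB.instance Definition _ :=
  GRing.isZmodule.Build tensor tensor_addA tensor_addC tensor_add0 tensor_addN.

Fact tensor_mulA : associative tensor_mul.
Proof.
elim/tensor_ofW => s; elim/tensor_ofW => t; elim/tensor_ofW => u.
rewrite !tensor_mulE; apply/tensor_ofP => V f bf.
rewrite !formal_eval_mul; apply: eq_bigr => p _.
rewrite formal_eval_mul; apply: eq_bigr => q _.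
by apply: eq_bigr => r _; rewrite !mulrA.
Qed.

Fact tensor_mul1l : left_id (tensor_of [:: (1, 1)]) tensor_mul.
Proof.
elim/tensor_ofW => s; rewrite tensor_mulE; apply/tensor_ofP => V f bf.
rewrite formal_eval_mul /formal_eval big_seq1.
by apply: eq_bigr => p _; rewrite !mul1r.
Qed.

Fact tensor_mul1r : right_id (tensor_of [:: (1, 1)]) tensor_mul.
Proof.
elim/tensor_ofW => s; rewrite tensor_mulE; apply/tensor_ofP => V f bf.
rewrite formal_eval_mul; apply: eq_bigr => p _.
by rewrite /formal_eval big_seq1 !mulr1.
Qed.

Fact tensor_mulDl : left_distributive tensor_mul +%R.
Proof.
elim/tensor_ofW => s; elim/tensor_ofW => t; elim/tensor_ofW => u.
rewrite /GRing.add /= tensor_addE !tensor_mulE tensor_addE.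
apply/tensor_ofP => V f bf.
by rewrite formal_eval_cat !formal_eval_mul formal_eval_cat.
Qed.

Fact tensor_mulDr : right_distributive tensor_mul +%R.
Proof.
elim/tensor_ofW => s; elim/tensor_ofW => t; elim/tensor_ofW => u.
rewrite /GRing.add /= tensor_addE !tensor_mulE tensor_addE.
apply/tensor_ofP => V f bf; rewrite formal_eval_cat !formal_eval_mul -big_split.
by apply: eq_bigr => p _; rewrite formal_eval_cat.
Qed.

HB.instance Definition _ :=
  GRing.Zmodule_isPzRing.Build tensor
    tensor_mulA tensor_mul1l tensor_mul1r tensor_mulDl tensor_mulDr.

Fact tensor_scaleA c d u :
  tensor_scale c (tensor_scale d u) = tensor_scale (c * d) u.
Proof.
elim/tensor_ofW: u => s; rewrite !tensor_scaleE /formal_scale -map_comp.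
by congr tensor_of; apply: eq_map => p /=; rewrite mulrA.
Qed.

Fact tensor_scale1 : left_id 1 tensor_scale.
Proof.
elim/tensor_ofW => s; rewrite tensor_scaleE; congr tensor_of.
by rewrite /formal_scale -[RHS]map_id; apply: eq_map => -[c x]; rewrite mul1r.
Qed.

Fact tensor_scaleDr : right_distributive tensor_scale +%R.
Proof.
move=> c; elim/tensor_ofW => s; elim/tensor_ofW => t.
by rewrite /GRing.add /= tensor_addE !tensor_scaleE tensor_addE -map_cat.
Qed.

Fact tensor_scaleDl u : {morph tensor_scale^~ u : c d / c + d}.
Proof.
elim/tensor_ofW: u => s c d; rewrite !tensor_scaleE [RHS]tensor_addE.
apply/tensor_ofP => V f [fDl _ _ _].
rewrite formal_eval_cat !formal_eval_scale -big_split.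
by apply: eq_bigr => p _; rewrite mulrDl fDl.
Qed.

HB.instance Definition _ :=
  GRing.Zmodule_isLmodule.Build E tensor
    tensor_scaleA tensor_scale1 tensor_scaleDr tensor_scaleDl.

Definition pure_tensor (c : E) (x : A) : tensor := tensor_of [:: (c, x)].

Lemma pure_tensorDl c d x :
  pure_tensor (c + d) x = pure_tensor c x + pure_tensor d x.
Proof.
rewrite [RHS]tensor_addE; apply/tensor_ofP => V f [fDl _ _ _].
by rewrite /formal_eval big_cat !big_seq1 fDl.
Qed.

Lemma pure_tensorDr c x y :
  pure_tensor c (x + y) = pure_tensor c x + pure_tensor c y.
Proof.
rewrite [RHS]tensor_addE; apply/tensor_ofP => V f [_ fDr _ _].
by rewrite /formal_eval big_cat !big_seq1 fDr.
Qed.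

Lemma pure_tensorZ k c x : pure_tensor (iota k * c) x = pure_tensor c (k *: x).
Proof.
apply/tensor_ofP => V f [_ _ fZl fZr].
by rewrite /formal_eval !big_seq1 fZl fZr.
Qed.

Lemma scale_pure_tensor c d x :
  c *: pure_tensor d x = pure_tensor (c * d) x.
Proof. by rewrite [LHS]tensor_scaleE. Qed.

Lemma mul_pure_tensor c d x y :
  pure_tensor c x * pure_tensor d y = pure_tensor (c * d) (x * y).
Proof. by rewrite [LHS]tensor_mulE. Qed.

Lemma pure_tensor1 : pure_tensor 1 1 = 1.
Proof. by []. Qed.

Lemma tensor_of_sum s : tensor_of s = \sum_(p <- s) pure_tensor p.1 p.2.
Proof.
elim: s => [|[c x] s IHs]; first by rewrite big_nil.
by rewrite big_cons -IHs [RHS]tensor_addE.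
Qed.

Lemma tensor_scaleAl c (u v : tensor) : c *: (u * v) = (c *: u) * v.
Proof.
elim/tensor_ofW: u => s; elim/tensor_ofW: v => t.
rewrite [u in c *: u]tensor_mulE [LHS]tensor_scaleE [c *: _]tensor_scaleE.
rewrite [RHS]tensor_mulE; apply/tensor_ofP => V f bf.
rewrite formal_eval_scale !formal_eval_mul [RHS]big_map.
by apply: eq_bigr => p _; apply: eq_bigr => q _; rewrite mulrA.
Qed.

Lemma tensor_scaleAr c (u v : tensor) : c *: (u * v) = u * (c *: v).
Proof.
elim/tensor_ofW: u => s; elim/tensor_ofW: v => t.
rewrite [u in c *: u]tensor_mulE [LHS]tensor_scaleE [c *: _]tensor_scaleE.
rewrite [RHS]tensor_mulE; apply/tensor_ofP => V f bf.
rewrite formal_eval_scale !formal_eval_mul; apply: eq_bigr => p _.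
by rewrite [RHS]big_map; apply: eq_bigr => q _; rewrite mulrCA.
Qed.

Lemma tensor_universal (V : lmodType K) (f : E -> A -> V) :
  bilinear_on f ->
  exists! g : tensor -> V,
    {morph g : u v / u + v} /\ forall c x, g (pure_tensor c x) = f c x.
Proof.
move=> bf; exists (fun u => formal_eval f (repr u)); split.
  split=> [u v|c x]; last by rewrite repr_tensor_of // /formal_eval big_seq1.
  by rewrite repr_tensor_of // formal_eval_cat.
move=> g [gD gf]; apply/funext; elim/tensor_ofW => s.
rewrite repr_tensor_of // tensor_of_sum.
have g0 : g 0 = 0 by apply: (addIr (g 0)); rewrite -gD !add0r.
by rewrite (big_morph g gD g0); apply: eq_bigr => p _; rewrite gf.
Qed.

End ScalarExtension.

Section LinearAlgebra.
Context {K : fieldType} {V : lmodType K}.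

Definition lin_indep n (v : 'I_n -> V) : Prop :=
  forall c : 'I_n -> K, \sum_i c i *: v i = 0 -> forall i, c i = 0.

Definition lin_span (X : set V) : set V :=
  [set x | exists n (c : 'I_n -> K) (v : 'I_n -> V),
     (forall i, X (v i)) /\ x = \sum_i c i *: v i].

Definition has_dim (W : set V) (n : nat) : Prop :=
  exists v : 'I_n -> V, lin_indep v /\ lin_span (range v) = W.

Definition fin_dim (W : set V) : Prop := exists n, has_dim W n.

(* Junk value 0 when W has no finite basis. *)
Definition dim (W : set V) : nat := xget 0%N (has_dim W).

End LinearAlgebra.

Definition alg_closure_of (K : fieldType) (E : closedFieldType)
  (iota : {rmorphism K -> E}) : Prop := forall x : E, algebraicOver iota x.

Definition is_domain (R : pzRingType) : Prop :=
  (1 : R) <> 0 /\ forall x y : R, x * y = 0 -> x = 0 \/ y = 0.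

Definition alg_center (R : pzRingType) : set R :=
  [set a | forall b, a * b = b * a].
Arguments alg_center : clear implicits.

Definition noncommutative (R : pzRingType) : Prop :=
  exists a b : R, a * b <> b * a.

Definition ad (R : pzRingType) (a b : R) : R := a * b - b * a.

Section GelfandKirillov.
Context (R : realType) {K : fieldType} (A : algType K).

Definition words (X : set A) (n : nat) : set A :=
  [set x | exists w : seq A,
     [/\ (size w <= n)%N, forall y, y \in w -> X y & x = \prod_(y <- w) y]].

(* lin_span (words W n) = K + W + ... + W^n.  The quotient by ln n is log_n    *)
(* for n >= 2; its values at n = 0, 1 do not affect the limsup.                *)
Definition GKdim : \bar R :=
  ereal_sup
    [set limn_esup (fun n : nat =>
           (ln ((dim (lin_span (words W n)))%:R : R) / ln (n%:R : R))%:E)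
    | W in [set W : set A | fin_dim W]].

End GelfandKirillov.

Section Dixmier.
Context {K : fieldType} {E : closedFieldType} (iota : {rmorphism K -> E}).
Context (A : algType K).
Implicit Types a b : A.

Definition centralizer a : set A := [set b | ad a b = 0].

Definition ad_nil a : set A := [set b | exists i, iter i.+1 (ad a) b = 0].

(* The sum of the eigenspaces of an endomorphism is automatically direct, so   *)
(* the direct sum is the set of finite sums of eigenvectors.                   *)
Definition ad_diag a : set A :=
  [set b | exists n (lambda : 'I_n -> E) (v : 'I_n -> tensor iota A),
     (forall i, ad (pure_tensor iota 1 a) (v i) = lambda i *: v i) /\
     pure_tensor iota 1 b = \sum_i v i].

Definition ad_orbit a b : set A :=
  [set x | exists p : {poly K}, x = \sum_(i < size p) p`_i *: iter i (ad a) b].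

Definition ad_fin a : set A := [set b | fin_dim (ad_orbit a b)].

Definition Delta1 : set A :=
  [set a | ~ alg_center A a /\ ad_nil a = setT /\ ad_diag a = centralizer a].

Definition Delta2 : set A :=
  [set a | ~ alg_center A a /\ centralizer a <> ad_nil a /\ ad_nil a <> setT /\
           ad_diag a = centralizer a].

Definition Delta3 : set A :=
  [set a | ~ alg_center A a /\ ad_nil a = centralizer a /\ ad_diag a = setT].

Definition Delta4 : set A :=
  [set a | ~ alg_center A a /\ ad_nil a = centralizer a /\
           centralizer a <> ad_diag a /\ ad_diag a = ad_fin a /\
           ad_fin a <> setT].

Definition Delta5 : set A :=
  [set a | ~ alg_center A a /\ ad_nil a = ad_diag a /\
           ad_diag a = centralizer a].

Definition Dixmier_partition : Prop :=
  ~` alg_center A = Delta1 `|` Delta2 `|` Delta3 `|` Delta4 `|` Delta5.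

End Dixmier.

(* Main.v *)
From HB Require Import structures.
Require Import Defs.
From mathcomp Require Import all_boot all_order all_algebra.
From mathcomp Require Import all_classical all_reals all_analysis.
Import Order.TTheory GRing.Theory Num.Theory.
Local Open Scope ring_scope.
Set Implicit Arguments.
Unset Strict Implicit.
Unset Printing Implicit Defensive.
Local Open Scope classical_set_scope.

(** Let a be a noncentral element, regard it in the scalar extension of A, and
    write ad a for its inner derivation there. Generalised eigenvectors of ad a
    multiply with their weights adding up (ad_shiftM). The theorem comes down to
    the fact that in Gelfand-Kirillov dimension less than 3 the derivation ad a
    cannot have both

    - an eigenvector x with [a, x] = lambda x and lambda nonzero, and
    - a Jordan block of size two: [a, y] = mu y + z, [a, z] = mu z, z nonzero.

    Otherwise all monomials y^k x^j a^i are linearly independent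
    (monomials_indep): such a monomial has weight k mu + j lambda, and it
    generates under ad a - (k mu + j lambda) a chain of length exactly k + 1,
    because k applications turn y^k into k! z^k, which is nonzero in a domain of
    characteristic zero. Since lambda is nonzero, weight and chain length
    determine k and j; and the powers of a are independent because a, not being
    central in a domain over an algebraically closed field, is transcendental.
    The elements x, y, a involve finitely many elements of A, which span a space
    W. At least n^3 / 27 of the monomials have degree at most n, and they lie in
    the scalar extension of the span of the words of length at most n in W, so
    this span has at least that dimension over K (GKdim_ge3_of_monomials).

    If there is no x as above, every diagonalisable element of A commutes with a
    (ad_diag_eigenvector), so D(a) = C(a), which leaves the types 1, 2 and 5. If
    there is one, there are no Jordan blocks. Then N(a) = C(a)
    (ad_nil_centralizer). Moreover an element of F(a) is annihilated by a
    polynomial in ad a, which splits over the algebraic closure, and so it is a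
    sum of eigenvectors (ad_fin_diag). Conversely D(a) is contained in F(a), as
    the eigenvalues are algebraic over K (ad_diag_fin). Hence D(a) = F(a), which
    leaves the types 3 and 4. Passing back from the scalar extension to A uses
    that A embeds in it, which is proved with a K-linear retraction of the
    algebraic closure onto K (pure1_inj). *)

(** * Spans and dimensions *)

Section Span.
Context {F : fieldType} {V : lmodType F}.
Implicit Types (P X Y : set V) (u v : V).

Definition subspace P := P 0 /\ forall c u v, P u -> P v -> P (c *: u + v).

Lemma subspace_sum P (I : finType) (c : I -> F) (v : I -> V) :
  subspace P -> (forall i, P (v i)) -> P (\sum_i c i *: v i).
Proof.
move=> [P0 PD] Pv; elim/big_ind: _ => // [u w Pu Pw|i _].
  by rewrite -[u]scale1r; apply: PD.
by rewrite -[_ *: _]addr0; apply: PD.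
Qed.

Lemma lin_span_min X P : subspace P -> X `<=` P -> lin_span X `<=` P.
Proof.
move=> sP XP _ [n [c [v [Xv ->]]]]; apply: subspace_sum => // i; exact: XP.
Qed.

Lemma sub_lin_span X : X `<=` lin_span X.
Proof.
move=> x Xx; exists 1%N, (fun=> 1), (fun=> x); split=> //.
by rewrite big_ord1 scale1r.
Qed.

Lemma lin_span_subspace X : subspace (lin_span X).
Proof.
split.
  by exists 0%N, (fun=> 0), (fun=> 0); split=> [[]|] //; rewrite big_ord0.
move=> e _ _ [n [c [u [Xu ->]]]] [m [d [v [Xv ->]]]].
pose cat (T : Type) (f : 'I_n -> T) (g : 'I_m -> T) (i : 'I_(n + m)) :=
  match fintype.split i with inl j => f j | inr j => g j end.
exists (n + m)%N, (cat F (fun i => e * c i) d), (cat V u v); split.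
  by move=> i; rewrite /cat; case: fintype.split.
rewrite big_split_ord /= scaler_sumr; congr (_ + _); apply: eq_bigr => i _.
  rewrite /cat; case: split_ordP => j /eqP; rewrite ?eq_shift // => /eqP <-.
  by rewrite scalerA.
by rewrite /cat; case: split_ordP => j /eqP; rewrite ?eq_shift // => /eqP <-.
Qed.

Lemma lin_spanS X Y : X `<=` Y -> lin_span X `<=` lin_span Y.
Proof.
move=> XY; apply: lin_span_min; first exact: lin_span_subspace.
by move=> x /XY; apply: sub_lin_span.
Qed.

Lemma lin_span_rangeP n (v : 'I_n -> V) u :
  lin_span (range v) u <-> exists d, u = \sum_j d j *: v j.
Proof.
split=> [|[d ->]]; last first.
  apply: subspace_sum => [|j]; first exact: lin_span_subspace.
  by apply: sub_lin_span; exists j.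
move: u; apply: lin_span_min => [|_ [i _ <-]].
  split; first by exists (fun=> 0); rewrite big1 // => i _; rewrite scale0r.
  move=> c _ _ [d ->] [e ->]; exists (fun i => c * d i + e i).
  rewrite scaler_sumr -big_split; apply: eq_bigr => i _ /=.
  by rewrite scalerDl scalerA.
exists (fun j => (j == i)%:R); rewrite (bigD1 i) //= eqxx scale1r big1 ?addr0 //.
by move=> j /negPf ->; rewrite scale0r.
Qed.

(** More vectors than generators: the matrix of coordinates has a nonzero
    vector in its left kernel. *)
Lemma indep_card_le (I : finType) M (v : I -> V) (u : 'I_M -> V) :
  (forall c : I -> F, \sum_i c i *: v i = 0 -> forall i, c i = 0) ->
  (forall i, lin_span (range u) (v i)) -> (#|I| <= M)%N.
Proof.
move=> vI vu.
have /choice[d vE] i : exists d, v i = \sum_j d j *: u j.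
  exact/lin_span_rangeP.
rewrite leqNgt; apply/negP => ltMI.
pose C : 'M[F]_(#|I|, M) := \matrix_(i, j) d (enum_val i) j.
have kerC : kermx C != 0.
  rewrite kermx_eq0; apply/negP => /eqP rC.
  by have := rank_leq_col C; rewrite rC leqNgt ltMI.
have [r rC r0] : exists2 r : 'rV_#|I|, r *m C = 0 & r != 0.
  case/rowV0Pn: kerC => r /sub_kermxP rC r0; by exists r.
case/eqP: r0; apply/rowP => i; rewrite mxE.
rewrite -(enum_valK i); apply: (vI (fun k => r 0 (enum_rank k))).
under eq_bigr => k _ do rewrite vE scaler_sumr.
rewrite exchange_big /= big1 // => j _.
under eq_bigr => k _ do rewrite scalerA.
rewrite -scaler_suml [X in X *: _](_ : _ = 0) ?scale0r //.
transitivity ((r *m C) 0 j); last by rewrite rC mxE.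
rewrite mxE (reindex (@enum_val I I)); last exact/onW_bij/enum_val_bij.
by apply: eq_bigr => k _; rewrite enum_valK mxE.
Qed.

(** Adding generators one at a time, a generator that is not in the span of the
    previous ones extends a basis of that span. *)
Lemma fin_dim_span (s : seq V) : fin_dim (lin_span [set` s]).
Proof.
elim: s => [|x s [n [v [vI vs]]]].
  exists 0%N, (fun=> 0); split=> [c _ []|] //.
  by congr lin_span; apply/seteqP; split=> [_ [[]]|] //.
have [xs|xNs] := pselect (lin_span [set` s] x).
  exists n, v; split=> //; rewrite vs; apply/seteqP; split.
    by apply: lin_spanS => y /= ys; rewrite inE ys orbT.
  apply: lin_span_min => [|y /=]; first exact: lin_span_subspace.
  by rewrite inE => /predU1P[->|ys] //; apply: sub_lin_span.
pose w (i : 'I_n.+1) := if unlift ord0 i is Some j then v j else x.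
have w0 : w ord0 = x by rewrite /w unlift_none.
have wS j : w (lift ord0 j) = v j by rewrite /w liftK.
exists n.+1, w; split.
  move=> c; rewrite big_ord_recl w0 => sum0.
  have c0 : c ord0 = 0.
    apply/eqP/negPn/negP => c0; case: xNs; rewrite -vs; apply/lin_span_rangeP.
    exists (fun j => - (c ord0)^-1 * c (lift ord0 j)).
    under eq_bigr => j _ do rewrite -scalerA -wS.
    rewrite -scaler_sumr; apply: (scalerI c0).
    rewrite scalerA mulrN divff // scaleN1r.
    by apply/eqP; rewrite -addr_eq0; apply/eqP.
  move=> i; case: (unliftP ord0 i) => [j ->|-> //].
  apply: (vI (fun j => c (lift ord0 j))).
  rewrite -[RHS]sum0 c0 scale0r add0r.
  by apply: eq_bigr => k _; rewrite wS.
have Sw : lin_span [set` s] `<=` lin_span (range w).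
  by rewrite -vs; apply: lin_spanS => _ [j _ <-]; exists (lift ord0 j).
apply/seteqP; split; (apply: lin_span_min; first exact: lin_span_subspace).
  move=> _ [i _ <-]; case: (unliftP ord0 i) => [j ->|->].
    rewrite wS; have: lin_span [set` s] (v j).
      by rewrite -vs; apply: sub_lin_span; exists j.
    by apply: lin_spanS => y /= ys; rewrite inE ys orbT.
  by rewrite w0; apply: sub_lin_span; rewrite /= mem_head.
move=> y /=; rewrite inE => /predU1P[->|ys].
  by apply: sub_lin_span; exists ord0.
exact/Sw/sub_lin_span.
Qed.

Lemma dimP (W : set V) : fin_dim W -> has_dim W (Defs.dim W).
Proof. exact: xgetPex. Qed.

End Span.

(** * Polynomials in a linear operator *)

Section PolyAct.
Context {F : fieldType} {V : lmodType F} (f : V -> V).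
Hypothesis f_lin : linear f.
Implicit Types (p q : {poly F}) (u v : V).

Definition poly_act p u := \sum_(i < size p) p`_i *: iter i f u.

Lemma linear_fun0 : f 0 = 0.
Proof. by have := f_lin (-1) 0 0; rewrite !scaler0 scaleN1r addr0 addNr. Qed.

Lemma linear_funZ c u : f (c *: u) = c *: f u.
Proof. by rewrite -[c *: u]addr0 f_lin linear_fun0 addr0. Qed.

Lemma linear_funD u v : f (u + v) = f u + f v.
Proof. by rewrite -[u]scale1r f_lin !scale1r. Qed.

Let iterL i c u v : iter i f (c *: u + v) = c *: iter i f u + iter i f v.
Proof. by elim: i => //= i ->; rewrite f_lin. Qed.

Lemma poly_act_wide n p u :
  (size p <= n)%N -> poly_act p u = \sum_(i < n) p`_i *: iter i f u.
Proof.
move=> pn; rewrite /poly_act (big_ord_widen n (fun i => p`_i *: iter i f u)) //.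
rewrite big_mkcond; apply: eq_bigr => i _; case: ltnP => // h.
by rewrite nth_default // scale0r.
Qed.

Lemma poly_actD p q u : poly_act (p + q) u = poly_act p u + poly_act q u.
Proof.
set n := maxn (size p) (size q).
rewrite !(@poly_act_wide n) ?leq_maxl ?leq_maxr ?size_polyD //.
by rewrite -big_split; apply: eq_bigr => i _; rewrite coefD scalerDl.
Qed.

Lemma poly_actC c u : poly_act c%:P u = c *: u.
Proof.
by rewrite (@poly_act_wide 1) ?size_polyC_leq1 // big_ord1 coefC.
Qed.

Lemma poly_act_linear p : linear (poly_act p).
Proof.
move=> c u v; rewrite /poly_act scaler_sumr -big_split; apply: eq_bigr => i _ /=.
by rewrite iterL scalerDr !scalerA mulrC.
Qed.

Lemma poly_act0 p : poly_act p 0 = 0.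
Proof.
by have := poly_act_linear p (-1) 0 0; rewrite !scaler0 scaleN1r addr0 addNr.
Qed.

Lemma poly_actZ p c u : poly_act p (c *: u) = c *: poly_act p u.
Proof. by rewrite -[c *: u]addr0 poly_act_linear poly_act0 addr0. Qed.

Lemma poly_act_sum p (I : Type) (r : seq I) (v : I -> V) :
  poly_act p (\sum_(i <- r) v i) = \sum_(i <- r) poly_act p (v i).
Proof.
elim/big_rec2: _ => [|i x y _ <-]; first exact: poly_act0.
by rewrite -[v i]scale1r poly_act_linear !scale1r.
Qed.

Lemma poly_actMX p u : poly_act (p * 'X) u = f (poly_act p u).
Proof.
rewrite (@poly_act_wide (size p).+1); last first.
  by rewrite (leq_trans (size_polyMleq _ _)) // size_polyX addn2.
rewrite big_ord_recl coefMX scale0r add0r /poly_act.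
rewrite (big_morph f linear_funD linear_fun0); apply: eq_bigr => i _.
by rewrite coefMX /= linear_funZ.
Qed.

Lemma poly_actM p q u : poly_act (p * q) u = poly_act p (poly_act q u).
Proof.
elim/poly_ind: p u => [|p c IHp] u.
  by rewrite mul0r !poly_actC !scale0r.
rewrite mulrDl poly_actD -mulrA ['X * q]mulrC mulrA poly_actMX IHp.
rewrite poly_actD poly_actMX poly_actC mul_polyC; congr (_ + _).
rewrite (@poly_act_wide (size q)) ?size_scale_leq // scaler_sumr.
by apply: eq_bigr => i _; rewrite coefZ scalerA.
Qed.

Lemma poly_act_XsubC c u : poly_act ('X - c%:P) u = f u - c *: u.
Proof.
by rewrite poly_actD -polyCN poly_actC -['X]mul1r poly_actMX poly_actC scale1r
  scaleNr.
Qed.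

Lemma poly_act_eigen p c u : f u = c *: u -> poly_act p u = p.[c] *: u.
Proof.
move=> fu; rewrite horner_coef scaler_suml; apply: eq_bigr => i _.
rewrite -scalerA; congr (_ *: _).
elim: (nat_of_ord i) => [|j /= ->]; first by rewrite expr0 scale1r.
by rewrite linear_funZ fu scalerA exprSr.
Qed.

End PolyAct.

(** * Generalised eigenvectors of an inner derivation *)

Section Weights.
Context {F : fieldType} {T : algType F} (a : T).
Implicit Types (mu nu : F) (u v x y z : T).

Lemma ad_linear : linear (ad a).
Proof.
move=> c u v; rewrite /ad mulrDr mulrDl -scalerAr -scalerAl scalerBr opprD.
by rewrite addrACA.
Qed.

Definition ad_shift nu u := ad a u - nu *: u.

Lemma poly_act_ad_shift nu n u :
  poly_act (ad a) (('X - nu%:P) ^+ n) u = iter n (ad_shift nu) u.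
Proof.
elim: n => [|n IHn]; first by rewrite expr0 poly_actC scale1r.
by rewrite exprS (poly_actM ad_linear) (poly_act_XsubC ad_linear) IHn.
Qed.

Lemma ad_shift_linear nu : linear (ad_shift nu).
Proof.
move=> c u v; rewrite /ad_shift ad_linear; move: (ad a u) (ad a v) => u' v'.
rewrite scalerBr scalerDr !scalerA.
by rewrite opprD addrACA [nu * c]mulrC.
Qed.

Lemma ad_shiftD nu u v : ad_shift nu (u + v) = ad_shift nu u + ad_shift nu v.
Proof. by rewrite -[u]scale1r ad_shift_linear !scale1r. Qed.

Lemma ad_shift0 nu : ad_shift nu 0 = 0.
Proof. by rewrite /ad_shift /ad mulr0 mul0r scaler0 !subr0. Qed.

Lemma iter_ad_shift0 nu n : iter n (ad_shift nu) 0 = 0.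
Proof. by elim: n => //= n ->; rewrite ad_shift0. Qed.

Lemma ad_shiftZ nu c u : ad_shift nu (c *: u) = c *: ad_shift nu u.
Proof. by rewrite -[c *: u]addr0 ad_shift_linear ad_shift0 addr0. Qed.

(** The Leibniz rule: weights add up under multiplication. *)
Lemma ad_shiftM mu nu u v :
  ad_shift (mu + nu) (u * v) = ad_shift mu u * v + u * ad_shift nu v.
Proof.
rewrite /ad_shift /ad scalerDl mulrBl mulrBr -scalerAl -scalerAr mulrBl mulrBr.
rewrite !mulrA opprD; set p := a * u * v; set q := u * a * v.
set r := u * v * a; set s := mu *: _; set t := nu *: _.
by rewrite [RHS]addrACA [_ - q + _]addrA subrK.
Qed.

Lemma iter_ad_shiftMr mu nu u v n : ad_shift nu v = 0 ->
  iter n (ad_shift (mu + nu)) (u * v) = iter n (ad_shift mu) u * v.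
Proof.
by move=> v0; elim: n => //= n ->; rewrite ad_shiftM v0 mulr0 addr0.
Qed.

Lemma ad_shiftX nu u k :
  ad_shift nu u = 0 -> ad_shift (k%:R * nu) (u ^+ k) = 0.
Proof.
move=> u0; elim: k => [|k IHk].
  by rewrite /ad_shift /ad mul0r scale0r mul1r mulr1 subrr subr0.
by rewrite exprSr -natr1 mulrDl mul1r ad_shiftM IHk u0 mul0r mulr0 addr0.
Qed.

(** As z is killed by ad a - nu, in the Leibniz expansion of the iterate at most
    one of the differentiations falls on y. *)
Lemma iter_ad_shiftM_jordan mu nu u y z n :
  ad_shift nu y = z -> ad_shift nu z = 0 ->
  iter n.+1 (ad_shift (mu + nu)) (u * y) =
  iter n.+1 (ad_shift mu) u * y + n.+1%:R *: (iter n (ad_shift mu) u * z).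
Proof.
move=> yz z0; elim: n => [|n IHn]; first by rewrite /= ad_shiftM yz scale1r.
rewrite iterS IHn ad_shiftD ad_shiftZ !ad_shiftM yz z0 mulr0 addr0.
rewrite -addrA -[X in _ + (X + _)]scale1r -scalerDl /= addrC.
by rewrite -natr1 [1 + _]addrC addrC.
Qed.

(** The k-th power of the end of a Jordan chain of length two ends a chain of
    length exactly k + 1: each factor has to be differentiated once. *)
Lemma iter_ad_shiftX mu y z k :
  ad_shift mu y = z -> ad_shift mu z = 0 ->
  iter k (ad_shift (k%:R * mu)) (y ^+ k) = k`!%:R *: z ^+ k.
Proof.
move=> yz z0.
have nil j : iter j.+1 (ad_shift (j%:R * mu)) (y ^+ j) = 0 /\
             iter j (ad_shift (j%:R * mu)) (y ^+ j) = j`!%:R *: z ^+ j.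
  elim: j => [|j [IH0 IH]].
    by rewrite /= /ad_shift /ad mul0r scale0r mul1r mulr1 subrr subr0 scale1r.
  rewrite exprSr -natr1 mulrDl mul1r; split.
    rewrite (iter_ad_shiftM_jordan _ _ _ yz) // iterS IH0 ad_shift0 mul0r add0r.
    by rewrite mul0r scaler0.
  rewrite (iter_ad_shiftM_jordan _ _ _ yz) // IH0 IH mul0r add0r.
  by rewrite -scalerAl scalerA -exprSr factS natrM.
by case: (nil k).
Qed.

End Weights.

Lemma natr_inj (F : fieldType) :
  [pchar F] =i pred0 -> injective (fun n => n%:R : F).
Proof.
move=> /pcharf0P F0 m n; wlog mn : m n / (m <= n)%N => [wlogmn|/= e].
  by case/orP: (leq_total m n) => mn e; [|symmetry]; apply: wlogmn.
by apply/eqP; rewrite eqn_leq mn -subn_eq0 -F0 natrB // e subrr /=.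
Qed.

(** * The monomials of a Jordan block and an eigenvector *)

Lemma domain_mul_neq0 (T : pzRingType) (u v : T) :
  is_domain T -> u != 0 -> v != 0 -> u * v != 0.
Proof. by move=> [_ dom] u0 v0; apply/eqP => /dom [] /eqP; apply/negP. Qed.

Lemma domain_exp_neq0 (T : pzRingType) (u : T) n :
  is_domain T -> u != 0 -> u ^+ n != 0.
Proof.
move=> dom u0; elim: n => [|n IHn]; first by rewrite expr0; apply/eqP; case: dom.
by rewrite exprS domain_mul_neq0.
Qed.

(** Over an algebraically closed field a polynomial splits, so an element of a
    domain is a root of it only if it is a scalar. *)
Lemma noncentral_transcendental (E : closedFieldType) (T : algType E) (a : T)
    (p : {poly E}) :
  is_domain T -> ~ alg_center T a -> p != 0 -> horner_alg a p != 0.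
Proof.
move=> dom aNZ p0; have [r ->] := closed_field_poly_normal p.
rewrite -mul_polyC rmorphM /= horner_algC rmorph_prod.
apply: (domain_mul_neq0 dom).
  rewrite scaler_eq0; apply/norP; split; first by rewrite lead_coef_eq0.
  by apply/eqP; case: dom.
elim: r => [|c r IHr]; first by rewrite big_nil; apply/eqP; case: dom.
rewrite big_cons domain_mul_neq0 // rmorphB /= horner_algX horner_algC subr_eq0.
apply/eqP => ac; apply: aNZ => b.
by rewrite ac -scalerAl -scalerAr mulr1 mul1r.
Qed.

Section Monomials.
Context {E : closedFieldType} {T : algType E}.
Context (E0 : [pchar E] =i pred0) (dom : is_domain T).
Context (a x y z : T) (lambda mu : E).
Hypotheses (lambda0 : lambda != 0) (x0 : x != 0) (z0 : z != 0).
Hypotheses (ax : ad a x = lambda *: x) (ay : ad a y = mu *: y + z).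
Hypothesis (az : ad a z = mu *: z).

Let ax0 : ad_shift a lambda x = 0. Proof. by rewrite /ad_shift ax subrr. Qed.
Let ayz : ad_shift a mu y = z.
Proof. by rewrite /ad_shift ay addrC addKr. Qed.
Let az0 : ad_shift a mu z = 0. Proof. by rewrite /ad_shift az subrr. Qed.

Let aNZ : ~ alg_center T a.
Proof.
move=> /(_ x) /eqP; rewrite -subr_eq0 -/(ad a x) ax scaler_eq0.
by rewrite (negPf lambda0) (negPf x0).
Qed.

Let weight (k j : nat) : E := k%:R * mu + j%:R * lambda.

Let weight_injr k i j : weight k i = weight k j -> i = j.
Proof. by move=> /addrI /(mulIf lambda0) /(natr_inj E0). Qed.

Let iter_weight k j g n : ad a g = 0 ->
  iter n (ad_shift a (weight k j)) (y ^+ k * x ^+ j * g) =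
  iter n (ad_shift a (k%:R * mu)) (y ^+ k) * (x ^+ j * g).
Proof.
move=> ag; rewrite -mulrA iter_ad_shiftMr // -[_ * lambda]addr0 ad_shiftM.
by rewrite ad_shiftX // mul0r add0r /ad_shift ag scale0r subr0 mulr0.
Qed.

Let iter_weight_top k j g : ad a g = 0 ->
  iter k (ad_shift a (weight k j)) (y ^+ k * x ^+ j * g) =
  k`!%:R *: (z ^+ k * x ^+ j * g).
Proof.
by move=> ag; rewrite iter_weight // (iter_ad_shiftX _ ayz) // -scalerAl mulrA.
Qed.

Let weight_top k j g : ad a g = 0 ->
  ad a (z ^+ k * x ^+ j * g) = weight k j *: (z ^+ k * x ^+ j * g).
Proof.
move=> ag; apply/eqP; rewrite -subr_eq0; apply/eqP.
rewrite -/(ad_shift a _ _) -[weight k j]addr0 !ad_shiftM !ad_shiftX //.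
by rewrite mul0r mulr0 addr0 mul0r add0r /ad_shift ag scale0r subr0 mulr0.
Qed.

Let iter_weight_gt k j g n : ad a g = 0 -> (k < n)%N ->
  iter n (ad_shift a (weight k j)) (y ^+ k * x ^+ j * g) = 0.
Proof.
move=> ag /subnK <-; rewrite addnS -addSn iterD iter_weight_top // iterS.
elim: (n - _)%N => [|i IHi]; last by rewrite iterS IHi ad_shift0.
by rewrite /= ad_shiftZ /ad_shift weight_top // subrr scaler0.
Qed.

Let ad_horner_alg (p : {poly E}) : ad a (horner_alg a p) = 0.
Proof. by rewrite /ad -{1 4}[a]horner_algX -!rmorphM mulrC subrr. Qed.

(** Suppose that a combination of the monomials vanishes. Among the coefficients
    g (k, j), polynomials in a, that are nonzero take one with k maximal, and
    let w be its weight. Some polynomial in ad a kills the terms of other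
    weights, and so do k applications of ad a - w to the terms of weight w with
    a lower power of y; as lambda is nonzero, weight and power of y determine
    the power of x, so that one single term survives. *)
Lemma monomials_indep m (c : 'I_m * 'I_m * 'I_m -> E) :
  \sum_t c t *: (y ^+ t.1.1 * x ^+ t.1.2 * a ^+ t.2) = 0 -> forall t, c t = 0.
Proof.
pose q (s : 'I_m * 'I_m) : {poly E} := \sum_(i < m) c (s, i) *: 'X^i.
pose g s := horner_alg a (q s).
pose u (s : 'I_m * 'I_m) := y ^+ s.1 * x ^+ s.2 * g s.
have gE s : g s = \sum_(i < m) c (s, i) *: a ^+ i.
  rewrite /g /q rmorph_sum; apply: eq_bigr => i _ /=.
  by rewrite -mul_polyC rmorphM rmorphXn /= horner_algX horner_algC mulr_algl.
have ag s : ad a (g s) = 0 by exact: ad_horner_alg.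
have -> : \sum_t c t *: (y ^+ t.1.1 * x ^+ t.1.2 * a ^+ t.2) = \sum_s u s.
  transitivity (\sum_t c (t.1, t.2) *: (y ^+ t.1.1 * x ^+ t.1.2 * a ^+ t.2)).
    by apply: eq_bigr => -[].
  rewrite -(pair_bigA _ (fun s i =>
    c (s, i) *: (y ^+ s.1 * x ^+ s.2 * a ^+ i))) /=.
  apply: eq_bigr => s _; rewrite /u gE mulr_sumr; apply: eq_bigr => i _.
  by rewrite -scalerAr.
move=> u0 [s1 i1]; apply/eqP/negPn/negP => c1.
have g1 : g s1 != 0.
  apply: noncentral_transcendental => //; apply: contraNneq c1 => q1.
  have := congr1 (fun p : {poly E} => p`_i1) q1; rewrite coef0 coef_sum.
  rewrite (bigD1 i1) //= coefZ coefXn eqxx mulr1 big1 ?addr0 => [->|i ii1] //.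
  by rewrite coefZ coefXn eq_sym (negPf (ii1 : i != i1 :> nat)) mulr0.
case: (@arg_maxnP _ s1 (fun s => g s != 0) (fun s => s.1) g1) => s0 g0 max0.
pose w (s : 'I_m * 'I_m) := weight s.1 s.2.
pose r := \prod_(s | w s != w s0) ('X - (w s)%:P) ^+ m.
have r0 : r.[w s0] != 0.
  rewrite /r horner_prod; apply/prodf_neq0 => s ws.
  by rewrite horner_exp hornerXsubC expf_neq0 // subr_eq0 eq_sym.
have kill s : s != s0 ->
    poly_act (ad a) (r * ('X - (w s0)%:P) ^+ s0.1) (u s) = 0.
  move=> ss0; have [ws|ws] := eqVneq (w s) (w s0).
    rewrite (poly_actM (ad_linear a)) poly_act_ad_shift -ws.
    have [gs|gs] := eqVneq (g s) 0.
      by rewrite /u gs mulr0 iter_ad_shift0 poly_act0 //; exact: ad_linear.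
    suff lt0 : (s.1 < s0.1)%N.
      by rewrite iter_weight_gt // poly_act0 //; exact: ad_linear.
    rewrite ltn_neqAle [X in _ && X](max0 s gs) andbT; apply: contraNneq ss0 => e1.
    case: s s0 e1 ws {r r0 u0 g0 max0 gs} => [k j] [k0 j0] /= /val_inj -> ws.
    by move/weight_injr/val_inj: ws => /= ->.
  rewrite /r (bigD1 s ws) /= mulrC mulrA mulrC mulrA.
  rewrite (poly_actM (ad_linear a)) poly_act_ad_shift iter_weight_gt //.
  by rewrite poly_act0 //; exact: ad_linear.
have := congr1 (poly_act (ad a) (r * ('X - (w s0)%:P) ^+ s0.1)) u0.
rewrite poly_act0; last exact: ad_linear.
rewrite poly_act_sum; last exact: ad_linear.
rewrite (bigD1 s0) //= [X in _ + X]big1 ?addr0; last exact: kill.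
rewrite (poly_actM (ad_linear a)) poly_act_ad_shift iter_weight_top //.
rewrite poly_actZ; last exact: ad_linear.
rewrite (poly_act_eigen (ad_linear a) _ (weight_top _ _ (ag s0))).
apply/eqP; rewrite !scaler_eq0 (negPf r0) ((pcharf0P E).1 E0).
by rewrite eqn0Ngt fact_gt0 /= !(mulf_neq0, domain_mul_neq0, domain_exp_neq0).
Qed.

End Monomials.

(** * Growth *)

Section Growth.
Context {F : fieldType} {A : algType F}.
Implicit Types (W : set A) (m n : nat).

Lemma wordsS W m n : (m <= n)%N -> words W m `<=` words W n.
Proof.
by move=> mn _ [w [wm Ww ->]]; exists w; split=> //; apply: leq_trans mn.
Qed.

Lemma words1 W n : words W n 1.
Proof. by exists [::]; rewrite big_nil. Qed.

Lemma sub_words W : W `<=` words W 1.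
Proof.
move=> x Wx; exists [:: x]; rewrite big_seq1; split=> // y.
by rewrite inE => /eqP ->.
Qed.

Lemma wordsM W m n x y : words W m x -> words W n y -> words W (m + n) (x * y).
Proof.
move=> [v [vm Wv ->]] [w [wn Ww ->]]; exists (v ++ w).
rewrite big_cat size_cat leq_add //; split=> // z.
by rewrite mem_cat => /orP[/Wv|/Ww].
Qed.

(** As multiplication is bilinear, the words of length at most n in a basis of W
    span those in W; there are finitely many of them. *)
Lemma fin_dim_words W n : fin_dim W -> fin_dim (lin_span (words W n)).
Proof.
move=> [d [b [_ bW]]].
have Wb i : W (b i) by rewrite -bW; apply: sub_lin_span; exists i.
suff [s [sw ws]] : exists s : seq A, (forall u, u \in s -> words W n u) /\
    words W n `<=` lin_span [set` s].
  suff -> : lin_span (words W n) = lin_span [set` s] by exact: fin_dim_span.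
  apply/seteqP; split; apply: lin_span_min => //; try exact: lin_span_subspace.
  by move=> u /sw /sub_lin_span.
elim: n => [|n [s [sw ws]]].
  exists [:: 1]; split=> [u|_ [w [+ _ ->]]].
    by rewrite inE => /eqP ->; exact: words1.
  by rewrite leqn0 => /nilP ->; rewrite big_nil; apply: sub_lin_span; rewrite /= inE.
pose s' := 1 :: [seq b i * u | i <- enum 'I_d, u <- s].
have s'sp := @lin_span_subspace _ _ [set` s'].
exists s'; split=> [u|_ [[|x w] [wn Ww ->]]].
- rewrite inE => /predU1P[->|/allpairsP[[i v] /= [_ vs ->]]]; first exact: words1.
  by rewrite -add1n; apply: wordsM; [exact/sub_words|exact: sw].
- by rewrite big_nil; apply: sub_lin_span; rewrite /= mem_head.
rewrite big_cons.
have : lin_span [set` s] (\prod_(y <- w) y).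
  by apply: ws; exists w; split=> // y yw; apply: Ww; rewrite inE yw orbT.
have : W x by apply: Ww; rewrite mem_head.
rewrite -bW => /lin_span_rangeP[c ->].
move: (\prod_(y <- w) y); apply: lin_span_min.
  split=> [|e u v IHu IHv]; first by rewrite mulr0; case: s'sp.
  by rewrite mulrDr -scalerAr; apply: s'sp.2.
move=> u /= us; rewrite mulr_suml.
under eq_bigr do rewrite -scalerAl.
apply: subspace_sum => // i; apply: sub_lin_span; rewrite /= inE; apply/orP; right.
by apply/allpairsP; exists (i, u); rewrite mem_enum.
Qed.

(** For n >= d and m = n %/ d one has n <= 2 d m, so that ln (m ^ e) is at least
    e (ln n - ln (2 d)); divided by ln n this tends to e. *)
Lemma GKdim_ge (R : realType) W (d e : nat) : fin_dim W -> (0 < d)%N ->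
  (forall m n, (d * m <= n)%N -> (m ^ e <= Defs.dim (lin_span (words W n)))%N) ->
  (e%:R%:E <= GKdim R A)%E.
Proof.
move=> Wfin d0 dimW; apply: le_trans (ereal_sup_ubound _); last by exists W.
apply: le_ereal_inf_tmp => _ [V [N _ NV] <-].
apply/lee_subgt0Pr => eps eps0.
(* Large enough to lie in V, and for e ln (2 d) / ln n to be at most eps. *)
pose n : nat := maxn (maxn N d)
  (maxn 2 (Num.truncn (expR (e%:R * ln (2 * d)%:R / eps) : R)).+1).
have nN : (N <= n)%N by rewrite /n !leq_max leqnn.
have nd : (d <= n)%N by rewrite /n !leq_max leqnn orbT.
have n2 : (2 <= n)%N by rewrite /n !leq_max leqnn !orbT.
have n1 : (1 < n%:R :> R) by rewrite ltr1n.
have lnn0 : 0 < ln (n%:R : R) by rewrite ln_gt0.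
have neps : e%:R * ln (2 * d)%:R <= eps * ln n%:R :> R.
  rewrite mulrC [X in _ <= X]mulrC -ler_pdivrMr // mulrC.
  rewrite -ler_expR lnK ?posrE ?(lt_trans _ n1) //.
  apply/ltW; apply: lt_le_trans (truncnS_gt _) _.
  by rewrite ler_nat /n !leq_max leqnn !orbT.
apply: le_trans (ereal_sup_ubound _); last by exists n => //; exact: NV.
rewrite -EFinB lee_fin ler_pdivlMr //.
set m := (n %/ d)%N.
have m0 : (0 < m)%N by rewrite divn_gt0.
have nm : (n <= 2 * d * m)%N.
  rewrite -mulnA mul2n -addnn {1}(divn_eq n d) mulnC leq_add //.
  by rewrite (leq_trans (ltnW (ltn_pmod n d0))) // leq_pmulr.
have := dimW m n; rewrite mulnC leq_trunc_div => /(_ isT) mdim.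
apply: (@le_trans _ _ (ln (m ^ e)%:R)); last first.
  rewrite ler_ln ?posrE ?ltr0n ?expn_gt0 ?m0 ?ler_nat //.
  by apply: leq_trans mdim; rewrite expn_gt0 m0.
rewrite natrX lnXn ?ltr0n // mulrBl lerBlDr.
apply: (@le_trans _ _ (e%:R * ln (2 * d * m)%:R)).
  rewrite ler_wpM2l // ler_ln ?posrE ?ltr0n ?ler_nat //.
    exact: leq_trans n2.
  by rewrite !muln_gt0 d0 m0.
rewrite natrM lnM ?posrE ?ltr0n ?muln_gt0 ?d0 // mulrDr addrC.
rewrite -[ln m%:R *+ e]mulr_natl.
by rewrite lerD2l.
Qed.

End Growth.

(** * Scalar extension *)

Section Retraction.
Context {K E : fieldType} (iota : {rmorphism K -> E}).

(** The kernel of the retraction is a K-subspace of E that is maximal among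
    those not containing 1. *)
Lemma scalar_retraction : exists f : E -> K,
  (forall k c d, f (iota k * c + d) = k * f c + f d) /\ f 1 = 1.
Proof.
(* The empty set satisfies P, being the union of the empty chain. *)
pose P (S : set E) :=
  (forall k c d, S c -> S d -> S (iota k * c + d)) /\ ~ S 1.
have [S [[Sl S1] Smax]] : exists S, P S /\ forall B, S `<` B -> ~ P B.
  apply: Zorn_bigcup => C CP Ctot; split=> [k c d [X CX Xc] [Y CY Yd]|[X CX X1]].
    have [XY|YX] := Ctot X Y CX CY.
      by exists Y => //; apply: (CP _ CY).1 => //; apply: XY.
    by exists X => //; apply: (CP _ CX).1 => //; apply: YX.
  by case: (CP _ CX).
have S0 : S 0.
  apply: contrapT => NS0; apply: (Smax (S `|` [set 0])).
    split; first by move=> c; left.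
    by move=> /(_ 0 (or_intror erefl)).
  split=> [k c d|[//|/eqP]]; last by rewrite oner_eq0.
  move=> [Sc|->] [Sd|->]; rewrite ?mulr0 ?addr0 ?add0r.
  - by left; apply: Sl.
  - case: NS0; have := Sl (-1) c c Sc Sc.
    by rewrite rmorphN1 mulN1r addNr.
  - by left.
  - by right.
have SN c : S c -> S (- c).
  by move=> Sc; have := Sl (-1) c 0 Sc S0; rewrite rmorphN1 mulN1r addr0.
have SK k : S (iota k) -> k = 0.
  move=> Sk; apply/eqP/negPn/negP => k0; apply: S1.
  have := Sl k^-1 _ _ Sk S0.
  by rewrite fmorphV mulVf ?addr0 // fmorph_eq0.
have ex c : exists k, S (c - iota k).
  apply: contrapT => Nc.
  apply: (Smax [set u | exists k, S (u - iota k * c)]).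
    split=> [u Su|]; first by exists 0; rewrite rmorph0 mul0r subr0.
    move=> /(_ c) => h; apply: Nc; exists 0; rewrite rmorph0 subr0; apply: h.
    by exists 1; rewrite rmorph1 mul1r subrr.
  split=> [k u v [i Su] [j Sv]|[k Sk]].
    exists (k * i + j); have := Sl k _ _ Su Sv.
    by rewrite rmorphD rmorphM mulrBr mulrDl addrACA -opprD mulrA.
  have [k0|k0] := eqVneq k 0.
    by apply: S1; move: Sk; rewrite k0 rmorph0 mul0r subr0.
  apply: Nc; exists k^-1; have := Sl (- k^-1) _ _ Sk S0.
  rewrite addr0 rmorphN mulNr mulrBr mulr1 opprB mulrA -rmorphM mulVf //.
  by rewrite rmorph1 mul1r.
have [f fS] := choice ex.
have fE c k : S (c - iota k) -> f c = k.
  move=> Sk; apply/eqP; rewrite -subr_eq0; apply/eqP/SK.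
  have := Sl (-1) _ _ (fS c) Sk; rewrite rmorphN1 mulN1r opprB addrA subrK.
  by rewrite rmorphB.
exists f; split=> [k c d|]; last by apply: fE; rewrite rmorph1 subrr.
apply: fE; have := Sl k _ _ (fS c) (fS d).
by rewrite mulrBr addrACA -opprD -rmorphM -rmorphD.
Qed.

End Retraction.

Section Embedding.
Context {K : fieldType} {E : closedFieldType} (iota : {rmorphism K -> E}).
Context {A : algType K}.
Implicit Types (a b x y : A) (u v : tensor iota A).

Local Notation pure := (pure_tensor iota (A := A) 1).

(** A K-linear retraction f of E onto K gives the left inverse c (x) x |-> f c x. *)
Lemma pure1_inj : injective pure.
Proof.
have [f [f_lin f1]] := scalar_retraction iota.
have f0 : f 0 = 0.
  by have := f_lin (-1) 0 0; rewrite rmorphN1 mulr0 addr0 mulN1r addNr.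
have bf : bilinear_on iota (fun c x => f c *: x : A).
  split=> [x c d|c x y|k c x|k c x].
  - by rewrite -[c]mul1r -(rmorph1 iota) f_lin rmorph1 !mul1r scalerDl.
  - by rewrite scalerDr.
  - by rewrite -[_ * c]addr0 f_lin f0 addr0 scalerA.
  - by rewrite !scalerA mulrC.
have [g [[_ gf] _]] := tensor_universal bf.
by move=> x y /(congr1 g); rewrite !gf f1 !scale1r.
Qed.

Lemma pure1Z k x : pure (k *: x) = iota k *: pure x.
Proof. by rewrite -pure_tensorZ scale_pure_tensor. Qed.

Lemma pure1_0 : pure 0 = 0.
Proof. by rewrite -[X in pure X](scale0r (0 : A)) pure1Z rmorph0 scale0r. Qed.

Lemma pure1B x y : pure (x - y) = pure x - pure y.
Proof.
by rewrite pure_tensorDr -scaleN1r pure1Z rmorphN1 scaleN1r.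
Qed.

Lemma pure1_sum (I : finType) (v : I -> A) :
  pure (\sum_i v i) = \sum_i pure (v i).
Proof. exact: (big_morph _ (pure_tensorDr iota 1) pure1_0). Qed.

Lemma ad_pure1 a b : ad (pure a) (pure b) = pure (ad a b).
Proof. by rewrite /ad !mul_pure_tensor mulr1 pure1B. Qed.

Lemma poly_act_pure1 a p b :
  poly_act (ad (pure a)) (map_poly iota p) (pure b) = pure (poly_act (ad a) p b).
Proof.
rewrite /poly_act size_map_poly pure1_sum; apply: eq_bigr => i _.
rewrite pure1Z coef_map; congr (_ *: _).
by elim: (nat_of_ord i) => //= k ->; rewrite ad_pure1.
Qed.

Definition scalar_span (W : set A) : set (tensor iota A) := lin_span (pure @` W).

Lemma scalar_spanS W W' : W `<=` W' -> scalar_span W `<=` scalar_span W'.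
Proof. by move=> WW'; apply: lin_spanS; exact: image_subset. Qed.

Lemma scalar_span_lin_span W : scalar_span (lin_span W) `<=` scalar_span W.
Proof.
apply: lin_span_min; first exact: lin_span_subspace.
move=> _ [_ [n [c [v [Wv ->]]]] <-]; rewrite pure1_sum.
under eq_bigr do rewrite pure1Z.
apply: subspace_sum; first exact: lin_span_subspace.
by move=> i; apply: sub_lin_span; exists (v i).
Qed.

Lemma tensor_finite u : exists s : seq A, scalar_span [set` s] u.
Proof.
rewrite -(tensor_reprK u) tensor_of_sum; exists [seq p.2 | p <- repr u].
set s := [seq p.2 | p <- _]; have [S0 SD] := lin_span_subspace (pure @` [set` s]).
rewrite big_seq; elim/big_ind: _ => [//|v w Hv Hw|p pu].
  by rewrite -[v]scale1r; apply: SD.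
rewrite -[p.1]mulr1 -scale_pure_tensor -[_ *: _]addr0; apply: SD => //.
by apply: sub_lin_span; exists p.2 => //=; apply: map_f.
Qed.

Lemma scalar_span_wordsM W m n u v :
  scalar_span (words W m) u -> scalar_span (words W n) v ->
  scalar_span (words W (m + n)) (u * v).
Proof.
move=> + Hv; move: u; apply: lin_span_min.
  split=> [|c u w Hu Hw]; first by rewrite mul0r; apply: (lin_span_subspace _).1.
  by rewrite mulrDl -tensor_scaleAl; apply: (lin_span_subspace _).2.
move=> _ [x Wx <-]; move: v Hv; apply: lin_span_min.
  split=> [|c u w Hu Hw]; first by rewrite mulr0; apply: (lin_span_subspace _).1.
  by rewrite mulrDr -tensor_scaleAr; apply: (lin_span_subspace _).2.
move=> _ [y Wy <-]; rewrite mul_pure_tensor mulr1; apply: sub_lin_span.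
by exists (x * y) => //; apply: wordsM.
Qed.

Lemma scalar_span_wordsX W u k :
  scalar_span W u -> scalar_span (words W k) (u ^+ k).
Proof.
move=> Wu; elim: k => [|k IHk].
  by apply: sub_lin_span; exists 1 => //; exact: words1.
rewrite exprS -add1n; apply: scalar_span_wordsM => //.
by apply: scalar_spanS Wu; apply: sub_words.
Qed.

(** The monomials of degree at most n in u, v, w lie in the scalar extension of
    the span of the words of length at most n in the finitely many elements of
    A that u, v, w involve, and extending scalars does not raise dimensions. *)
Lemma GKdim_ge3_of_monomials (R : realType) u v w :
  (forall m (c : 'I_m * 'I_m * 'I_m -> E),
     \sum_t c t *: (u ^+ t.1.1 * v ^+ t.1.2 * w ^+ t.2) = 0 ->
     forall t, c t = 0) ->
  (3%:E <= GKdim R A)%E.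
Proof.
move=> indep.
have [su Hu] := tensor_finite u; have [sv Hv] := tensor_finite v.
have [sw Hw] := tensor_finite w.
pose W := lin_span [set` su ++ sv ++ sw].
have Wfin : fin_dim W by exact: fin_dim_span.
have sub s : {subset s <= su ++ sv ++ sw} ->
    scalar_span [set` s] `<=` scalar_span W.
  by move=> ss; apply: scalar_spanS => x /ss; apply: sub_lin_span.
have Wu : scalar_span W u by apply: sub Hu => x xs; rewrite !mem_cat xs.
have Wv : scalar_span W v by apply: sub Hv => x xs; rewrite !mem_cat xs orbT.
have Ww : scalar_span W w by apply: sub Hw => x xs; rewrite !mem_cat xs !orbT.
apply: (@GKdim_ge _ _ R W 3 3) => // m n mn.
have := dimP (fin_dim_words n Wfin); move: (Defs.dim _) => M [b [_ bW]].
have := @indep_card_le _ _ _ _ (fun t : 'I_m * 'I_m * 'I_m =>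
  u ^+ t.1.1 * v ^+ t.1.2 * w ^+ t.2) (pure \o b) (indep m).
rewrite !card_prod !card_ord expnSr -mulnn; apply=> t.
suff : scalar_span (words W n) (u ^+ t.1.1 * v ^+ t.1.2 * w ^+ t.2).
  move=> /(scalar_spanS (@sub_lin_span _ _ _)); rewrite -bW.
  move=> /scalar_span_lin_span; apply: lin_spanS.
  by move=> _ [_ [i _ <-] <-]; exists i.
have tn : (t.1.1 + t.1.2 + t.2 <= n)%N.
  apply: leq_trans mn; rewrite !mulSn mul0n addn0 addnA.
  by rewrite !leq_add // ltnW // ltn_ord.
apply: scalar_spanS (wordsS tn) _ _.
by do 2?apply: scalar_span_wordsM; apply: scalar_span_wordsX.
Qed.

End Embedding.

(** * Locally finite and diagonalisable vectors *)

Section LocallyFinite.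
Context {F : fieldType} {V : lmodType F} (f : V -> V).
Hypothesis f_lin : linear f.
Implicit Types (p q : {poly F}) (u v w : V).

(** If the orbit of u has dimension n, the first n + 1 iterates are dependent;
    conversely, division by an annihilating p leaves polynomials of size less
    than that of p. *)
Lemma fin_dim_orbitP u :
  fin_dim [set x | exists p, x = poly_act f p u] <->
  exists2 p, p != 0 & poly_act f p u = 0.
Proof.
split=> [[n [b [_ bO]]]|[p p0 pu]].
  apply: contrapT => nop.
  suff : (#|'I_n.+1| <= n)%N by rewrite card_ord ltnn.
  apply: (@indep_card_le _ _ _ _ (fun i : 'I_n.+1 => iter i f u) b) => [c c0 i|i].
    apply: contrapT => /eqP ci; apply: nop; exists (\poly_(j < n.+1) c (inord j)).
      apply: contraNneq ci => p0; have := congr1 (fun p : {poly F} => p`_i) p0.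
      by rewrite coef_poly ltn_ord inord_val coef0 => ->.
    rewrite (@poly_act_wide _ _ f n.+1) ?size_poly // -[RHS]c0; apply: eq_bigr => j _.
    by rewrite coef_poly ltn_ord inord_val.
  rewrite bO; exists 'X^i; rewrite /poly_act size_polyXn (bigD1 ord_max) //=.
  rewrite coefXn eqxx scale1r big1 ?addr0 // => j ji.
  by rewrite coefXn (negPf (ji : j != i :> nat)) scale0r.
pose s := [seq iter i f u | i <- iota 0 (size p)].
suff -> : [set x | exists p, x = poly_act f p u] = lin_span [set` s].
  exact: fin_dim_span.
apply/seteqP; split=> [_ [q ->]|].
  rewrite (divp_eq q p) poly_actD (poly_actM f_lin) pu (poly_act0 f_lin) add0r.
  apply: subspace_sum => [|i]; first exact: lin_span_subspace.
  apply: sub_lin_span; apply: map_f; rewrite mem_iota /=.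
  exact: ltn_trans (ltn_ord i) (ltn_modpN0 _ p0).
apply: lin_span_min => [|_ /mapP[i _ ->]].
  split; first by exists 0; rewrite poly_actC scale0r.
  move=> c _ _ [q ->] [r ->]; exists (c *: q + r).
  by rewrite poly_actD -mul_polyC (poly_actM f_lin) poly_actC.
exists 'X^i; elim: i => [|i IHi]; first by rewrite expr0 poly_actC scale1r.
by rewrite exprSr (poly_actMX f_lin) -IHi.
Qed.

Definition eigenvector : set V := [set v | exists c, f v = c *: v].

Lemma lin_span_eigenvectorP u :
  lin_span eigenvector u <->
  exists n (c : 'I_n -> F) (v : 'I_n -> V),
    (forall i, f (v i) = c i *: v i) /\ u = \sum_i v i.
Proof.
split=> [[n [d [v [/choice[c vc] ->]]]]|[n [c [v [vc ->]]]]]; last first.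
  exists n, (fun=> 1), v; split=> [i|]; first by exists (c i).
  by apply: eq_bigr => i _; rewrite scale1r.
exists n, c, (fun i => d i *: v i); split=> // i.
by rewrite (linear_funZ f_lin) vc !scalerA mulrC.
Qed.

(** Modulo the c-eigenvectors, f - c maps the sums of eigenvectors onto
    themselves. *)
Lemma lin_span_eigenvector_preim c w : lin_span eigenvector w ->
  exists v w',
    [/\ lin_span eigenvector v, f w' = c *: w' & w = f v - c *: v + w'].
Proof.
have [E0 ED] := lin_span_subspace eigenvector.
have f0 := linear_fun0 f_lin; have fZ := linear_funZ f_lin.
move: w; apply: lin_span_min.
  split; first by exists 0, 0; split=> //; rewrite ?f0 ?scaler0 ?subr0 ?addr0.
  move=> e _ _ [v1 [w1 [Ev1 Ew1 ->]]] [v2 [w2 [Ev2 Ew2 ->]]].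
  exists (e *: v1 + v2), (e *: w1 + w2); split; first exact: ED.
    by rewrite f_lin Ew1 Ew2 scalerDr !scalerA mulrC.
  rewrite f_lin !scalerDr scalerN !scalerA [c * e]mulrC opprD.
  by rewrite addrACA; congr (_ + _); rewrite addrACA.
move=> w [d fw]; have [dc|dc] := eqVneq d c.
  by exists 0, w; split; rewrite // ?f0 ?scaler0 ?subr0 ?add0r // fw dc.
exists ((d - c)^-1 *: w), 0; split; last 1 first.
- rewrite fZ fw addr0 scalerA [c *: _]scalerA [c * _]mulrC -scalerBl -mulrBr.
  by rewrite mulVf ?scale1r // subr_eq0.
- by rewrite -[_ *: w]addr0; apply: ED => //; apply: sub_lin_span; exists d.
- by rewrite f0 scaler0.
Qed.

Definition no_jordan_block :=
  forall c v, f (f v - c *: v) = c *: (f v - c *: v) -> f v = c *: v.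

(** Removing one root c at a time: f u - c u is a sum of eigenvectors, and up to
    a c-eigenvector w it is the image under f - c of a sum v of eigenvectors. So
    (f - c) ^ 2 kills u - v, which must then be an eigenvector. *)
Lemma annihilated_lin_span_eigenvector (r : seq F) u :
  no_jordan_block ->
  poly_act f (\prod_(c <- r) ('X - c%:P)) u = 0 -> lin_span eigenvector u.
Proof.
move=> ss; elim: r u => [|c r IHr] u.
  rewrite big_nil -[1]/(1%:P) poly_actC scale1r => ->.
  exact: (lin_span_subspace _).1.
rewrite big_cons mulrC (poly_actM f_lin) (poly_act_XsubC f_lin).
move=> /IHr /(lin_span_eigenvector_preim c) [v [w [Ev fw uv]]].
have fuv : f (u - v) - c *: (u - v) = w.
  transitivity ((f u - c *: u) - (f v - c *: v)); last by rewrite uv addrC addKr.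
  have -> : f (u - v) = f u - f v.
    by rewrite addrC -scaleN1r f_lin scaleN1r addrC.
  rewrite scalerBr !opprB addrACA [RHS]addrACA; congr (_ + _); exact: addrC.
have Euv : eigenvector (u - v) by exists c; apply: ss; rewrite fuv.
rewrite -[u](subrK v) -[u - v]scale1r.
by apply: (lin_span_subspace _).2 => //; apply: sub_lin_span.
Qed.

End LocallyFinite.

(** * The dichotomy *)

Section Dichotomy.
Context {K : fieldType} {E : closedFieldType} (iota : {rmorphism K -> E}).
Context {A : algType K}.
Local Notation T := (tensor iota A).
Local Notation pure := (pure_tensor iota (A := A) 1).

(** An algebra structure presupposes that 1 differs from 0, which for the scalar
    extension is a hypothesis; it is carried as a parameter of this copy. *)
Definition nonzero_tensor of (1 : T) != 0 : Type := T.

HB.instance Definition _ (T1 : (1 : T) != 0) :=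
  GRing.PzRing.on (nonzero_tensor T1).
HB.instance Definition _ (T1 : (1 : T) != 0) :=
  GRing.PzSemiRing_isNonZero.Build (nonzero_tensor T1) T1.
HB.instance Definition _ (T1 : (1 : T) != 0) :=
  GRing.Lmodule.copy (nonzero_tensor T1) T.
HB.instance Definition _ (T1 : (1 : T) != 0) :=
  GRing.LSemiModule_isLSemiAlgebra.Build E (nonzero_tensor T1)
    (@tensor_scaleAl _ _ iota A).
HB.instance Definition _ (T1 : (1 : T) != 0) :=
  GRing.LSemiAlgebra_isSemiAlgebra.Build E (nonzero_tensor T1)
    (@tensor_scaleAr _ _ iota A).

Lemma ad_tensor_linear (a : T) : linear (ad a : T -> T).
Proof.
move=> c u v; rewrite /ad mulrDr mulrDl -tensor_scaleAr -tensor_scaleAl.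
by rewrite opprD addrACA scalerBr.
Qed.

Lemma pchar0_ext : [pchar K] =i pred0 -> [pchar E] =i pred0.
Proof.
move=> /pcharf0P K0; apply/pcharf0P => n.
by rewrite -(rmorph_nat iota) fmorph_eq0 K0.
Qed.

(** Next to an eigenvector x of nonzero eigenvalue, a Jordan block of size two
    with chain y, z would make the monomials in y, x and a independent, so that
    the algebra would have at least cubic growth. *)
Lemma eigenvector_no_jordan_block (R : realType) (a x : T) lambda :
  [pchar K] =i pred0 -> is_domain T -> (GKdim R A < 3%:E)%E ->
  lambda != 0 -> x != 0 -> ad a x = lambda *: x ->
  no_jordan_block (ad a : T -> T).
Proof.
move=> K0 dom GK lambda0 x0 ax mu y; set z := ad a y - mu *: y => az.
apply/eqP; rewrite -subr_eq0 -/z; apply/negPn/negP => z0.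
suff : (3%:E <= GKdim R A)%E by rewrite leNgt GK.
apply: (@GKdim_ge3_of_monomials _ _ iota _ R y x a) => m c.
have T1 : (1 : T) != 0 by apply/eqP; case: dom.
apply: (@monomials_indep E (nonzero_tensor T1) (pchar0_ext K0) dom a x y z
  lambda mu) => //.
by rewrite /z addrC subrK.
Qed.

(** If all eigenvalues in a decomposition of b were zero, a would commute with b
    in the scalar extension, hence in A. *)
Lemma ad_diag_eigenvector (a b : A) :
  ad_diag iota a b -> ad a b != 0 ->
  exists lambda (x : T),
    [/\ lambda != 0, x != 0 & ad (pure a) x = lambda *: x].
Proof.
move=> [n [c [v [vc bv]]]]; apply: contraNP => nox.
apply/eqP/(@pure1_inj _ _ iota); rewrite -ad_pure1 pure1_0 bv.
have [f0 fD] : ad (pure a) 0 = 0 /\ {morph ad (pure a) : u v / u + v}.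
  split=> [|u w]; first by rewrite /ad mulr0 mul0r subrr.
  by have := ad_tensor_linear (pure a) 1 u w; rewrite !scale1r.
rewrite (big_morph _ fD f0) big1 // => i _; rewrite vc.
have [->|c0] := eqVneq (c i) 0; first by rewrite scale0r.
have [->|v0] := eqVneq (v i) 0; first by rewrite scaler0.
by case: nox; exists (c i), (v i).
Qed.

Lemma ad_finP (a b : A) :
  ad_fin a b <-> exists2 p : {poly K}, p != 0 & poly_act (ad a) p b = 0.
Proof. exact: (fin_dim_orbitP (ad_linear a)). Qed.

(** The eigenvalues are algebraic over K, so that one nonzero polynomial over K
    vanishes at all of them. *)
Lemma ad_diag_fin (a : A) :
  alg_closure_of iota -> ad_diag iota a `<=` ad_fin a.
Proof.
move=> alg b [n [c [v [vc bv]]]]; apply/ad_finP.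
have /choice[q qP] i :
    exists q : {poly K}, q != 0 /\ root (map_poly iota q) (c i).
  by have [q q0 qc] := alg (c i); exists q.
exists (\prod_i q i); first by apply/prodf_neq0 => i _; case: (qP i).
apply: (@pure1_inj _ _ iota); rewrite pure1_0 -poly_act_pure1 bv.
rewrite (poly_act_sum (ad_tensor_linear _)) big1 // => i _.
rewrite (poly_act_eigen (ad_tensor_linear _) _ (vc i)) rmorph_prod horner_prod.
by rewrite (bigD1 i) //= (rootP (qP i).2) mul0r scale0r.
Qed.

(** An annihilating polynomial splits over E into linear factors. *)
Lemma ad_fin_diag (a : A) :
  no_jordan_block (ad (pure a) : T -> T) ->
  ad_fin a `<=` ad_diag iota a.
Proof.
move=> ss b /ad_finP[p p0 pb].
apply/(lin_span_eigenvectorP (ad_tensor_linear (pure a))).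
have [r rE] := closed_field_poly_normal (map_poly iota p).
apply: (annihilated_lin_span_eigenvector (ad_tensor_linear (pure a)) (r := r) ss).
have lp0 : lead_coef (map_poly iota p) != 0.
  by rewrite lead_coef_eq0 map_poly_eq0.
apply: (scalerI lp0); rewrite scaler0 -(poly_actC (ad (pure a))).
rewrite -(poly_actM (ad_tensor_linear _)) mul_polyC -rE poly_act_pure1 pb.
exact: pure1_0.
Qed.

(** An element of the nilspace outside the centralizer yields a Jordan block of
    eigenvalue 0. *)
Lemma ad_nil_centralizer (a : A) :
  no_jordan_block (ad (pure a) : T -> T) ->
  ad_nil a `<=` centralizer a.
Proof.
move=> ss b [i]; elim: i => [//|i IHi].
rewrite iterS iterS => h; apply: IHi; rewrite iterS.
apply: (@pure1_inj _ _ iota); rewrite pure1_0 -ad_pure1.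
rewrite -[RHS](scale0r (pure (iter i (ad a) b))); apply: ss.
by rewrite !scale0r subr0 !ad_pure1 h pure1_0.
Qed.

End Dichotomy.

Theorem corollary3p3 (R : realType) (K : fieldType) (Kbar : closedFieldType)
    (iota : {rmorphism K -> Kbar}) (A : algType K) :
  [pchar K] =i pred0 ->
  alg_closure_of iota ->
  noncommutative A ->
  is_domain A ->
  (GKdim R A < 3%:E)%E ->
  is_domain (tensor iota A) ->
  Dixmier_partition iota A.
Proof.
move=> K0 alg _ _ GK dom; apply/seteqP; split=> [a aNZ|a]; last first.
  by case=> [[[[[]|[]]|[]]|[]]|[]].
have CN : centralizer a `<=` ad_nil a by move=> b ab; exists 0%N.
have CD : centralizer a `<=` ad_diag iota a.
  move=> b ab; exists 1%N, (fun=> 0), (fun=> pure_tensor iota 1 b).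
  by rewrite big_ord1 ad_pure1 ab pure1_0 scale0r.
have [DC|] := pselect (ad_diag iota a `<=` centralizer a).
  have {CD}DC : ad_diag iota a = centralizer a by apply/seteqP.
  have [NC|NC] := pselect (ad_nil a = centralizer a).
    by right; rewrite /Delta5 /= NC DC.
  have [NT|NT] := pselect (ad_nil a = setT); first by do 4!left.
  by do 3!left; right; do !split=> //; apply/nesym.
move=> /existsNP[b /not_implyP[Db /eqP ab]].
have [lambda [x [lambda0 x0 ax]]] := ad_diag_eigenvector Db ab.
have ss := eigenvector_no_jordan_block K0 dom GK lambda0 x0 ax.
have NC : ad_nil a = centralizer a.
  by apply/seteqP; split=> //; apply: ad_nil_centralizer ss.
have DF : ad_diag iota a = ad_fin a.
  by apply/seteqP; split; [exact: ad_diag_fin|exact: ad_fin_diag].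
have [DT|DT] := pselect (ad_diag iota a = setT); first by do 2!left; right.
left; right; do !split=> //; last by rewrite -DF.
by move=> CDeq; move: Db; rewrite -CDeq => /eqP; apply/negP.
Qed.
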